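(* Let $G$ be an $(r,s)$-directed hypergraph and let $p,q\ge1$ be real numbers with $r/p+s/q=1$. Let $\overline G$ be the underlying hypergraph of the bipartite split $\mathcal B(G)$, and let $\rho(\overline G)$ be its spectral radius. (1) If $p\le q$, then $\lambda_{p,q}(G)\le \frac{1}{r^{r/p}s^{s/q}}\,\rho(\overline G)^{(r+s)/p}$. (2) If $p>q$, then $\lambda_{p,q}(G)\le \frac{1}{r^{r/p}s^{s/q}}\,\rho(\overline G)^{(r+s)/q}$. (3) If $p=q=r+s$, then $\lambda_{p,q}(G)=\frac{1}{\sqrt[r+s]{r^rs^s}}\,\rho(\overline G)$.
   Context: Let $r,s$ be positive integers. An $(r,s)$-directed hypergraph $G$ consists of a finite vertex set $V(G)$ and a finite set $E(G)$ of arcs. Each arc $e$ is an ordered pair $(T(e),H(e))$ of disjoint subsets of $V(G)$ (tail and head) with $|T(e)|=r$ and $|H(e)|=s$. Write $T(G)=\bigcup_eT(e)$ and $H(G)=\bigcup_eH(e)$. For real vectors $\mathbf{x}=(x_u)_{u\in T(G)}$ and $\mathbf{y}=(y_v)_{v\in H(G)}$, indexed independently, set $P_G(\mathbf x,\mathbf y)=\sum_{e\in E(G)}\prod_{u\in T(e)}x_u\prod_{v\in H(e)}y_v$. For real $p,q\ge1$ let $\lambda_{p,q}(G)=\max\{P_G(\mathbf x,\mathbf y):\|\mathbf x\|_p=\|\mathbf y\|_q=1\}$. The underlying hypergraph $\overline G$ of the bipartite split is the $(r+s)$-uniform hypergraph defined as follows: - its vertex set is $V_T\,\dot\cup\,V_H$,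 where $V_T$ is a copy of $T(G)$ and $V_H$ is a disjoint copy of $H(G)$; - for each arc $e$ of $G$ it has the edge $\overline e$ consisting of the copy of $T(e)$ in $V_T$ together with the copy of $H(e)$ in $V_H$. For a $k$-uniform hypergraph $\mathcal H$, the spectral radius is $\rho(\mathcal H)=\max\{k\sum_{f\in E(\mathcal H)}\prod_{v\in f}z_v:\ \mathbf z\in\mathbb R^{V(\mathcal H)},\ \|\mathbf z\|_k=1\}$. This is the spectral radius of the Cooper–Dutle adjacency tensor. *)

(* Defs.v *)
From mathcomp Require Import all_boot all_order all_algebra.
From mathcomp Require Import all_classical all_reals all_analysis.

Set Implicit Arguments.
Unset Strict Implicit.
Unset Printing Implicit Defensive.

Import Order.TTheory GRing.Theory Num.Theory.
Import numFieldNormedType.Exports.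

Local Open Scope ring_scope.

(* [hyperedges] is a set, hence hypergraphs have no multiple edges. *)
Record hypergraph (W : finType) (k : nat) := Hypergraph {
  hyperedges : {set {set W}};
  card_hyperedge : forall f, f \in hyperedges -> #|f| = k
}.

(* An arc is the pair (tail, head). *)
Record dihypergraph (V : finType) (r s : nat) := Dihypergraph {
  arcs : {set {set V} * {set V}};
  card_tail : forall e, e \in arcs -> #|e.1| = r;
  card_head : forall e, e \in arcs -> #|e.2| = s;
  disjoint_arc : forall e, e \in arcs -> [disjoint e.1 & e.2]
}.

Section Split.
Variables (V : finType) (r s : nat) (G : dihypergraph V r s).

Definition tails : {set V} := \bigcup_(e in arcs G) e.1.
Definition heads : {set V} := \bigcup_(e in arcs G) e.2.

Definition tailV : finType := {u : V | u \in tails}.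
Definition headV : finType := {v : V | v \in heads}.

Definition underlying_edges : {set {set V}} :=
  [set e.1 :|: e.2 | e in arcs G].

Lemma card_underlying_edge f : f \in underlying_edges -> #|f| = (r + s)%N.
Proof.
case/imsetP => e eG ->; rewrite cardsU (card_tail eG) (card_head eG).
by move: (disjoint_arc eG); rewrite -setI_eq0 => /eqP ->; rewrite cards0 subn0.
Qed.

Definition underlying : hypergraph V (r + s) := Hypergraph card_underlying_edge.

(* In the bipartite split, a vertex lying in both T(G) and H(G) has two copies,
   [inl] in the tail part and [inr] in the head part. *)
Definition split_tail (A : {set V}) : {set tailV + headV} :=
  [set inl u | u : tailV & val u \in A].
Definition split_head (A : {set V}) : {set tailV + headV} :=
  [set inr v | v : headV & val v \in A].

Definition split_arcs : {set {set tailV + headV} * {set tailV + headV}} :=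
  [set (split_tail e.1, split_head e.2) | e in arcs G].

Lemma card_split_tail e : e \in arcs G -> #|split_tail e.1| = #|e.1|.
Proof.
move=> eG; rewrite card_imset; last by move=> u v [].
rewrite -(card_imset _ val_inj); apply: eq_card => u.
apply/imsetP/idP => [[v + ->]|ue]; first by rewrite inE.
have uT : u \in tails by apply/bigcupP; exists e.
by exists (Sub u uT); rewrite ?inE SubK.
Qed.

Lemma card_split_head e : e \in arcs G -> #|split_head e.2| = #|e.2|.
Proof.
move=> eG; rewrite card_imset; last by move=> u v [].
rewrite -(card_imset _ val_inj); apply: eq_card => u.
apply/imsetP/idP => [[v + ->]|ue]; first by rewrite inE.
have uH : u \in heads by apply/bigcupP; exists e.
by exists (Sub u uH); rewrite ?inE SubK.
Qed.

Lemma split_arcs_tail e : e \in split_arcs -> #|e.1| = r.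
Proof. by case/imsetP => a aG -> /=; rewrite card_split_tail ?(card_tail aG). Qed.

Lemma split_arcs_head e : e \in split_arcs -> #|e.2| = s.
Proof. by case/imsetP => a aG -> /=; rewrite card_split_head ?(card_head aG). Qed.

Lemma split_arcs_disjoint e : e \in split_arcs -> [disjoint e.1 & e.2].
Proof.
case/imsetP => a aG -> /=; rewrite -setI_eq0; apply/eqP/setP => w.
by rewrite !inE; apply/negP => /andP[/imsetP[u _ ->] /imsetP[v _]].
Qed.

Definition bipartite_split : dihypergraph (tailV + headV)%type r s :=
  Dihypergraph split_arcs_tail split_arcs_head split_arcs_disjoint.

End Split.

Section Lagrangian.
Variable R : realType.

Definition pnorm (I : finType) (p : R) (x : I -> R) : R :=
  (\sum_i `|x i| `^ p) `^ p^-1.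

Definition dihyper_poly (V : finType) (r s : nat) (G : dihypergraph V r s)
    (x : tailV G -> R) (y : headV G -> R) : R :=
  \sum_(e in arcs G)
    (\prod_(u : tailV G | val u \in e.1) x u) *
    (\prod_(v : headV G | val v \in e.2) y v).

(* This maximum and the next one are attained as soon as there is an edge, see
   [dihyper_lambda_max] and [spectral_radius_max]. An edgeless G has no unit
   vector, and then the value is [sup set0 = 0]. *)
Definition dihyper_lambda (V : finType) (r s : nat) (p q : R)
    (G : dihypergraph V r s) : R :=
  sup [set t | exists (x : tailV G -> R) (y : headV G -> R),
    [/\ pnorm p x = 1, pnorm q y = 1 & t = dihyper_poly x y]]%classic.

Definition hyper_poly (W : finType) (k : nat) (K : hypergraph W k)
    (z : W -> R) : R :=
  k%:R * \sum_(f in hyperedges K) \prod_(v in f) z v.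

Definition spectral_radius (W : finType) (k : nat) (K : hypergraph W k) : R :=
  sup [set t | exists z : W -> R, pnorm k%:R z = 1 /\ t = hyper_poly K z]%classic.

End Lagrangian.

Section Attained.
Local Open Scope classical_set_scope.
Import ArrowAsProduct.
Variable R : realType.

Local Lemma continuous_norm_powR (p : R) :
  0 < p -> continuous (fun t : R => `|t| `^ p : R).
Proof.
move=> p0 t; have [->|t0] := eqVneq t 0.
  apply/cvgrPdist_lt => e e0; rewrite normr0 powR0 ?gt_eqF//.
  have d0 : 0 < e `^ p^-1 by rewrite powR_gt0.
  near=> u; rewrite sub0r normrN ger0_norm ?powR_ge0//.
  rewrite -[ltRHS]powRr1 ?ltW// -(mulVf (lt0r_neq0 p0)) powRrM.
  apply: gt0_ltr_powR; rewrite ?nnegrE ?powR_ge0//.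
apply: (@continuous_comp R R R (fun t : R => `|t|) (fun a : R => a `^ p) t).
  exact: norm_continuous.
apply: differentiable_continuous; apply/derivable1_diffP.
by apply: derivable_powR; rewrite in_itv/= andbT normr_gt0.
Unshelve. all: by end_near. Qed.

Local Lemma coord_continuous (I : finType) i : continuous (fun x : I -> R => x i).
Proof. exact: (@proj_continuous I (fun=> R) i). Qed.

Local Lemma prodr_continuous (T : topologicalType) (I : finType) (P : pred I)
    (F : I -> T -> R) :
  (forall i, P i -> continuous (F i)) ->
  continuous (fun x => \prod_(i | P i) F i x).
Proof. by apply: continuous_big => x; exact: mul_continuous. Qed.

Local Lemma sumr_continuous (T : topologicalType) (I : finType) (P : pred I)
    (F : I -> T -> R) :
  (forall i, P i -> continuous (F i)) ->
  continuous (fun x => \sum_(i | P i) F i x).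
Proof. by apply: continuous_big => x; exact: add_continuous. Qed.

Local Lemma pnorm_eq1 (I : finType) (p : R) (x : I -> R) :
  0 < p -> (pnorm p x = 1) <-> (\sum_i `|x i| `^ p = 1).
Proof.
move=> p0; have S0 : 0 <= \sum_i `|x i| `^ p.
  by apply: sumr_ge0 => i _; exact: powR_ge0.
split=> [h|h]; last by rewrite /pnorm h powR1.
apply: (@powR_injective _ p^-1); rewrite ?invr_gt0 ?nnegrE//.
by rewrite powR1.
Qed.

Local Lemma sphere_neq0 (I : finType) (p : R) (i0 : I) :
  0 < p -> [set x : I -> R | pnorm p x = 1] !=set0.
Proof.
move=> p0; exists (fun i => (i == i0)%:R); apply/pnorm_eq1 => //.
rewrite (bigD1 i0)//= eqxx normr1 powR1 big1 ?addr0// => i /negbTE ->.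
by rewrite normr0 powR0 ?gt_eqF.
Qed.

Local Lemma sphere_compact (I : finType) (p : R) :
  0 < p -> compact [set x : I -> R | pnorm p x = 1].
Proof.
move=> p0.
apply: (@subclosed_compact _ _ [set x : I -> R | forall i, `[-1, 1] (x i)]).
- pose N (x : I -> R) : R := \sum_i `|x i| `^ p.
  have -> : [set x : I -> R | pnorm p x = 1] = N @^-1` [set 1].
    by apply/seteqP; split=> x /=; rewrite pnorm_eq1.
  apply: preimage_closed; last exact: closed_eq.
  move=> x _; apply: (sumr_continuous (F := fun i (y : I -> R) => `|y i| `^ p)).
  move=> i _ y; apply: (@continuous_comp _ _ _ (fun y : I -> R => y i)
    (fun t : R => `|t| `^ p)); first exact: coord_continuous.
  exact: continuous_norm_powR.
- apply: (@tychonoff I (fun=> R) (fun=> `[-1, 1])) => i.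
  exact: segment_compact.
- move=> x /= /(pnorm_eq1 _ p0) x1 i; rewrite /= in_itv/= -ler_norml.
  have -> : `|x i| = (`|x i| `^ p) `^ p^-1.
    by rewrite -powRrM mulfV ?lt0r_neq0// powRr1.
  have -> : 1 = 1 `^ p^-1 :> R by rewrite powR1.
  apply: ge0_ler_powR;
    rewrite ?nnegrE ?powR_ge0 ?invr_ge0 ?(ltW p0)//.
  rewrite -x1 (bigD1 i)//= lerDl.
  by apply: sumr_ge0 => j _; exact: powR_ge0.
Qed.

Local Lemma sup_attained (T : topologicalType) (A : set T) (f : T -> R) :
  A !=set0 -> compact A -> continuous f ->
  exists2 c, A c & f c = sup (f @` A) /\ forall t, A t -> f t <= f c.
Proof.
move=> A0 cA cf.
have [c cA' cmax] := compact_EVT_max A0 cA (continuous_subspaceT cf).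
have {cA'}Ac := set_mem cA'.
have {}cmax t : A t -> f t <= f c by move=> At; apply: cmax; rewrite inE.
exists c => //; split => //; apply/eqP; rewrite eq_le; apply/andP; split.
  apply: ub_le_sup; last by exists c.
  by exists (f c) => _ [t At <-]; exact: cmax.
by apply: ge_sup; [exists (f c), c | move=> _ [t At <-]; exact: cmax].
Qed.

Lemma dihyper_lambda_max (V : finType) (r s : nat) (p q : R)
    (G : dihypergraph V r s) :
  (0 < r)%N -> (0 < s)%N -> 0 < p -> 0 < q -> arcs G != finset.set0 ->
  exists (x : tailV G -> R) (y : headV G -> R),
    [/\ pnorm p x = 1, pnorm q y = 1, dihyper_lambda p q G = dihyper_poly x y &
     forall (x' : tailV G -> R) (y' : headV G -> R),
       pnorm p x' = 1 -> pnorm q y' = 1 ->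
       dihyper_poly x' y' <= dihyper_poly x y].
Proof.
move=> r0 s0 p0 q0 /set0Pn[e eG].
have [u ue] : exists u, u \in e.1 by apply/card_gt0P; rewrite (card_tail eG).
have [v ve] : exists v, v \in e.2 by apply/card_gt0P; rewrite (card_head eG).
have uT : u \in tails G by apply/bigcupP; exists e.
have vH : v \in heads G by apply/bigcupP; exists e.
pose X := [set x : tailV G -> R | pnorm p x = 1].
pose Y := [set y : headV G -> R | pnorm q y = 1].
pose f (z : (tailV G -> R) * (headV G -> R)) := dihyper_poly z.1 z.2.
have fc : continuous f.
  apply: sumr_continuous => a _ z.
  apply: (@continuousM _ _
    (fun z : (tailV G -> R) * (headV G -> R) => \prod_(u | val u \in a.1) z.1 u)
    (fun z : (tailV G -> R) * (headV G -> R) => \prod_(v | val v \in a.2) z.2 v)).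
    apply: (prodr_continuous
      (F := fun u (z : (tailV G -> R) * (headV G -> R)) => z.1 u)) => i _ {}z.
    by apply: (@continuous_comp _ _ _ fst (fun x : tailV G -> R => x i));
      [exact: cvg_fst | exact: coord_continuous].
  apply: (prodr_continuous
    (F := fun v (z : (tailV G -> R) * (headV G -> R)) => z.2 v)) => i _ {}z.
  by apply: (@continuous_comp _ _ _ snd (fun y : headV G -> R => y i));
    [exact: cvg_snd | exact: coord_continuous].
have [] := @sup_attained _ (X `*` Y) f _ _ fc.
- have [x Xx] := sphere_neq0 (Sub u uT : tailV G) p0.
  by have [y Yy] := sphere_neq0 (Sub v vH : headV G) q0; exists (x, y).
- by apply: compact_setX; exact: sphere_compact.
move=> [x y] [/= x1 y1] [fE fmax]; exists x, y; split => //; last first.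
  by move=> x' y' x'1 y'1; exact: (fmax (x', y')).
transitivity (f (x, y)) => //; rewrite fE; congr sup.
apply/seteqP; split=> [_ [x' [y' [? ? ->]]]|_ [[x' y'] [/= ? ?] <-]].
  by exists (x', y').
by exists x', y'.
Qed.

Lemma spectral_radius_max (W : finType) (k : nat) (K : hypergraph W k) :
  (0 < k)%N -> hyperedges K != finset.set0 ->
  exists z : W -> R,
    [/\ pnorm k%:R z = 1, spectral_radius R K = hyper_poly K z &
     forall z' : W -> R, pnorm k%:R z' = 1 -> hyper_poly K z' <= hyper_poly K z].
Proof.
move=> k0 /set0Pn[f fK].
have [w wf] : exists w, w \in f by apply/card_gt0P; rewrite (card_hyperedge fK).
have k0' : 0 < k%:R :> R by rewrite ltr0n.
have Sc : continuous (fun z : W -> R =>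
    \sum_(f in hyperedges K) \prod_(v in f) z v).
  apply: sumr_continuous => g _; apply: prodr_continuous => i _.
  exact: coord_continuous.
have Pc : continuous (fun z : W -> R => hyper_poly K z).
  by move=> z; apply: (continuous_comp (Sc z)); exact: mulrl_continuous.
have [z z1 [zE zmax]] :=
  sup_attained (sphere_neq0 w k0') (@sphere_compact W _ k0') Pc.
exists z; split => //; rewrite zE; congr sup.
apply/seteqP; split=> [_ [z' [? ->]]|_ [z' ? <-]]; first by exists z'.
by exists z'.
Qed.

End Attained.

(* Main.v *)
Require Import Defs.
From mathcomp Require Import all_boot all_order all_algebra.
From mathcomp Require Import all_classical all_reals all_analysis.
From mathcomp Require Import ring lra.

(* Let (x, y) be a nonnegative maximizer, lambda the maximum, k = r + s, and w_e
   the monomial of the arc e at (x, y), so that the w_e sum to lambda. Give the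
   tail copy of u the weight (r x_u^p / k)^(1/k) and the head copy of v the
   weight (s y_v^q / k)^(1/k): this is a unit vector for the k-norm. With
   C = r^(r/p) s^(s/q), if p <= q, the product of the weights over the edge of e
   is at least (C lambda)^(p/k) w_e / (k lambda), and summing over the arcs
   gives (C lambda)^(p/k) <= rho. The edge estimate follows from
   w_e <= s lambda y_v^q for v in the head of e, a consequence of maximality.
   The case q < p is the same with tails and heads exchanged. When p = q = k, a
   unit vector on the split is cut into its tail and head parts, and homogeneity
   and the weighted AM-GM inequality give the converse bound. *)

Import Order.TTheory GRing.Theory Num.Theory.
Local Open Scope ring_scope.

(** * Elementary inequalities for real powers and logarithms *)

Section RealInequalities.
Set Implicit Arguments.
Unset Strict Implicit.
Variable R : realType.
Implicit Types a b t q x y : R.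

(** Young's inequality with the conjugate exponents [a^-1] and [b^-1], applied to [x]^ a[and]y
    [^ b]. *)
Lemma weighted_amgm a b x y : 0 < a -> 0 < b -> a + b = 1 ->
  0 <= x -> 0 <= y -> x `^ a * y `^ b <= a * x + b * y.
Proof.
move=> a0 b0 ab1 x0 y0.
have := @conjugate_powR R (x `^ a) (y `^ b) a^-1 b^-1 (powR_ge0 _ _)
  (powR_ge0 _ _).
rewrite !invr_gt0 !invrK -!powRrM !mulfV ?gt_eqF// !powRr1//.
by rewrite (mulrC x) (mulrC y); apply.
Qed.

Lemma powR1Dx_sub1_le q t : 0 < q -> 0 < t ->
  (1 + t) `^ q - 1 <= q * t * (1 + t) `^ q.
Proof.
move=> q0 t0; have t1 : 0 < 1 + t by lra.
have P0 : 0 < (1 + t) `^ q by rewrite powR_gt0.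
suff H : 1 - q * t <= ((1 + t) `^ q)^-1.
  have := ler_wpM2r (ltW P0) H; rewrite mulVf ?gt_eqF//; lra.
rewrite -powRN /powR gt_eqF// mulNr.
apply: le_trans (expR_ge1Dx _).
by rewrite lerD2l lerN2 ler_pM2l// le_ln1Dx//; lra.
Qed.

Lemma ln_prod (I : finType) (P : {pred I}) (F : I -> R) :
  (forall i, i \in P -> 0 < F i) ->
  ln (\prod_(i in P) F i) = \sum_(i in P) ln (F i).
Proof.
move=> F0.
(* The induction carries the positivity of the partial product, which [lnM] requires. *)
suff [] : 0 < \prod_(i in P) F i /\
  ln (\prod_(i in P) F i) = \sum_(i in P) ln (F i) by [].
apply: (big_rec2 (fun x y => 0 < x /\ ln x = y)) => [|i y x Pi [x0 <-]].
  by rewrite ln1.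
by rewrite mulr_gt0 ?F0// lnM ?posrE ?F0.
Qed.

End RealInequalities.

(** * Scaling nonnegative vectors to unit p-norm *)

Section Normalize.
Set Implicit Arguments.
Unset Strict Implicit.
Variables (R : realType) (K : finType) (p : R).
Implicit Types x : K -> R.
Hypothesis p0 : 0 < p.

Lemma powR_sum_eq0 x : (forall i, 0 <= x i) -> \sum_i x i `^ p = 0 ->
  forall i, x i = 0.
Proof.
move=> x0 /eqP; rewrite psumr_eq0 => [/allP h i|i _]; last exact: powR_ge0.
by have := h i (mem_index_enum i); rewrite powR_eq0 => /andP[/eqP].
Qed.

Lemma pnorm_normalize x : (forall i, 0 <= x i) -> \sum_i x i `^ p != 0 ->
  exists2 x', pnorm p x' = 1 &
    x = (fun i => (\sum_j x j `^ p) `^ p^-1 * x' i).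
Proof.
move=> x0; set N := \sum_i _ => NN0.
have N0 : 0 < N by rewrite lt0r NN0 sumr_ge0// => i _; exact: powR_ge0.
have M0 : 0 < N `^ p^-1 by rewrite powR_gt0.
exists (fun i => (N `^ p^-1)^-1 * x i); last first.
  by apply/funext => i; rewrite mulrA mulfV ?mul1r ?gt_eqF.
apply/Defs.pnorm_eq1 => //.
transitivity (\sum_i N^-1 * x i `^ p); last by rewrite -mulr_sumr mulVf.
apply: eq_bigr => i _; rewrite ger0_norm ?mulr_ge0 ?invr_ge0 ?(ltW M0)//.
rewrite powRM ?invr_ge0 ?(ltW M0)//; congr (_ * _).
by rewrite -powRN -powRrM mulNr mulVf ?gt_eqF// powRN powRr1 ?ltW.
Qed.

Lemma pnorm_norm x : pnorm p (fun i => `|x i|) = pnorm p x.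
Proof. by rewrite /pnorm; under eq_bigr do rewrite normr_id. Qed.

Lemma pnorm_void x : (K -> False) -> pnorm p x = 0.
Proof.
move=> K0; rewrite /pnorm big1; last by move=> i; have := K0 i.
by rewrite powR0// invr_eq0 gt_eqF.
Qed.

Lemma pnorm_eq1_ge0 x : (forall i, 0 <= x i) ->
  pnorm p x = 1 <-> \sum_i x i `^ p = 1.
Proof.
by move=> x0; rewrite Defs.pnorm_eq1//; under eq_bigr do rewrite ger0_norm//.
Qed.

End Normalize.

(** * Bihomogeneous forms of degree [r] in one vector and [s] in the other *)

Section Biform.
Set Implicit Arguments.
Unset Strict Implicit.
Variables (R : realType) (I J E : finType) (D : {set E}).
Variables (A : E -> {pred I}) (B : E -> {pred J}).

(** Arcs are abstracted to an index set with two families of predicates, so that exchanging tails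
    and heads is merely another instance. *)
Definition biform (x : I -> R) (y : J -> R) : R :=
  \sum_(e in D) (\prod_(u in A e) x u) * (\prod_(v in B e) y v).

Lemma biform_ge0 x y : (forall u, 0 <= x u) -> (forall v, 0 <= y v) ->
  0 <= biform x y.
Proof.
by move=> x0 y0; apply: sumr_ge0 => e _; rewrite mulr_ge0 ?prodr_ge0.
Qed.

Lemma biform_le_norm x y :
  biform x y <= biform (fun u => `|x u|) (fun v => `|y v|).
Proof.
by apply: ler_sum => e _; rewrite -!normr_prod -normrM ler_norm.
Qed.

Variables r s : nat.
Hypothesis r0 : (0 < r)%N.
Hypothesis s0 : (0 < s)%N.
Hypothesis card_A : forall e, e \in D -> #|A e| = r.
Hypothesis card_B : forall e, e \in D -> #|B e| = s.

Lemma biform_scale (a b : R) x y :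
  biform (fun u => a * x u) (fun v => b * y v) = a ^+ r * b ^+ s * biform x y.
Proof.
rewrite /biform mulr_sumr; apply: eq_bigr => e eD.
by rewrite !big_split/= !prodr_const card_A// card_B// mulrACA.
Qed.

Variables p q lam : R.
Hypothesis p1 : 1 <= p.
Hypothesis q1 : 1 <= q.
Hypothesis lamP :
  forall x y, pnorm p x = 1 -> pnorm q y = 1 -> biform x y <= lam.

Let p0 : 0 < p. Proof. exact: lt_le_trans p1. Qed.
Let q0 : 0 < q. Proof. exact: lt_le_trans q1. Qed.
Let rp0 : 0 < r%:R / p. Proof. by rewrite divr_gt0 ?ltr0n. Qed.
Let sq0 : 0 < s%:R / q. Proof. by rewrite divr_gt0 ?ltr0n. Qed.

(** Normalize both vectors and use bihomogeneity. If one of them is zero, both sides vanish, since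
    every monomial contains a factor from each vector. *)
Lemma biform_le_powR x y :
  (forall u, 0 <= x u) -> (forall v, 0 <= y v) ->
  biform x y <=
    (\sum_u x u `^ p) `^ (r%:R / p) * (\sum_v y v `^ q) `^ (s%:R / q) * lam.
Proof.
move=> x0 y0.
have [X0|XN] := eqVneq (\sum_u x u `^ p) 0.
  rewrite X0 powR0 ?gt_eqF// !mul0r [biform x y]big1// => e eD.
  have /card_gt0P[u ue] : (0 < #|A e|)%N by rewrite card_A.
  by rewrite (bigD1 u)//= (powR_sum_eq0 x0 X0) !mul0r.
have [Y0|YN] := eqVneq (\sum_v y v `^ q) 0.
  rewrite Y0 powR0 ?gt_eqF// mulr0 !mul0r [biform x y]big1// => e eD.
  have /card_gt0P[v ve] : (0 < #|B e|)%N by rewrite card_B.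
  by rewrite [X in _ * X](bigD1 v)//= (powR_sum_eq0 y0 Y0) !mul0r mulr0.
have [x' x'1 xE] := pnorm_normalize p0 x0 XN.
have [y' y'1 yE] := pnorm_normalize q0 y0 YN.
rewrite {1}xE {1}yE biform_scale.
rewrite -!powR_mulrn ?powR_ge0// -!powRrM ![_^-1 * _]mulrC.
by rewrite ler_wpM2l ?lamP// mulr_ge0 ?powR_ge0.
Qed.

(** With [a] and [b] the two power sums, [a + b = 1], weighted AM-GM for [a / r] and [b / s] with
    weights [r / p] and [s / q] bounds the factor in [biform_le_powR]: the weighted mean is
    [(a + b) / q = q^-1]. *)
Lemma degree_biform_le z z' : p = (r + s)%:R -> q = (r + s)%:R -> 0 <= lam ->
  (forall u, 0 <= z u) -> (forall v, 0 <= z' v) ->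
  \sum_u z u `^ (r + s)%:R + \sum_v z' v `^ (r + s)%:R = 1 ->
  (r + s)%:R * biform z z' <= r%:R `^ (r%:R / p) * s%:R `^ (s%:R / q) * lam.
Proof.
move=> pE qE lam0 z0 z'0; rewrite -{1}pE -qE.
have := biform_le_powR z0 z'0.
set a := \sum_u _; set b := \sum_v _ => h ab1.
have a0 : 0 <= a by apply: sumr_ge0 => *; exact: powR_ge0.
have b0 : 0 <= b by apply: sumr_ge0 => *; exact: powR_ge0.
have rR : 0 < r%:R :> R by rewrite ltr0n.
have sR : 0 < s%:R :> R by rewrite ltr0n.
have hpq : r%:R / p + s%:R / q = 1.
  by rewrite -qE in pE; rewrite pE -mulrDl -natrD -qE mulfV ?gt_eqF.
have := weighted_amgm rp0 sq0 hpq (divr_ge0 a0 (ltW rR)) (divr_ge0 b0 (ltW sR)).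
have powRV c e : 0 <= c -> c^-1 `^ e = (c `^ e)^-1 :> R.
  by move=> c0; rewrite -(powR_inv1 c0) -powRrM mulN1r powRN.
rewrite !powRM ?invr_ge0 ?ler0n// !powRV ?ler0n//.
have rpow : 0 < r%:R `^ (r%:R / p) :> R by exact: powR_gt0.
have spow : 0 < s%:R `^ (s%:R / q) :> R by exact: powR_gt0.
have -> : r%:R / p * (a / r%:R) + s%:R / q * (b / s%:R) = q^-1.
  rewrite -qE in pE; rewrite pE; transitivity ((a + b) / q).
    by field; rewrite !gt_eqF.
  by rewrite ab1 mul1r.
rewrite mulrACA -invfM ler_pdivrMr ?mulr_gt0// => amgm.
apply: le_trans (ler_wpM2l (ltW q0) h) _.
by rewrite mulrA ler_wpM2r// -ler_pdivlMl.
Qed.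

(** * Estimates at a nonnegative maximizer *)

Hypothesis hpq : r%:R / p + s%:R / q = 1.
Variables (x : I -> R) (y : J -> R).
Hypothesis x0 : forall u, 0 <= x u.
Hypothesis y0 : forall v, 0 <= y v.
Hypothesis x1 : pnorm p x = 1.
Hypothesis y1 : pnorm q y = 1.
Hypothesis lamE : biform x y = lam.

(* Compare with [y] where the entry at [v] is multiplied by [1 + t]; the form
   being multilinear, it increases by at least [t] times the weight of [e].
   Then take [t] small. *)
Lemma arc_weight_le e v : e \in D -> v \in B e ->
  (\prod_(u in A e) x u) * (\prod_(v in B e) y v) <= s%:R * lam * y v `^ q.
Proof.
move=> eD ve; set w := _ * _.
have lam0 : 0 <= lam by rewrite -lamE biform_ge0.
have step t : 0 < t -> w <= s%:R * lam * y v `^ q * (1 + t) `^ q.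
  move=> t0; have t1 : 0 <= 1 + t by lra.
  pose y' j := if j == v then (1 + t) * y j else y j.
  have yy' j : 0 <= y j <= y' j.
    rewrite y0/= /y'; case: ifP => // _.
    by rewrite ler_peMl ?y0//; lra.
  have y'0 j : 0 <= y' j by have /andP[h1 h2] := yy' j; exact: le_trans h2.
  have gain : lam + t * w <= biform x y'.
    rewrite -lamE /biform (bigD1 e)//= [leRHS](bigD1 e)//= addrAC.
    apply: lerD.
      rewrite /w !(bigD1 v ve)/= [y' v]/y' eqxx.
      rewrite [X in _ <= _ * (_ * X)](eq_bigr y); first by lra.
      by move=> j /andP[_ /negbTE]; rewrite /y' => ->.
    apply: ler_sum => f _; rewrite ler_wpM2l ?prodr_ge0//.
    by apply: ler_prod => j _; exact: yy'.
  have := le_trans gain (biform_le_powR x0 y'0).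
  rewrite (_ : \sum_u x u `^ p = 1); last exact/pnorm_eq1_ge0.
  rewrite powR1 mul1r.
  set N := \sum_j _.
  have NE : N = 1 + y v `^ q * ((1 + t) `^ q - 1).
    have := (pnorm_eq1_ge0 q0 y0).1 y1; rewrite (bigD1 v)//= => Y1.
    rewrite /N (bigD1 v)//= [y' v]/y' eqxx powRM//.
    rewrite (eq_bigr (fun j => y j `^ q)); first by lra.
    by move=> j /negbTE; rewrite /y' => ->.
  have N0 : 0 <= N by apply: sumr_ge0 => j _; exact: powR_ge0.
  have := weighted_amgm sq0 rp0 _ N0 ler01; rewrite addrC => /(_ hpq).
  rewrite powR1 !mulr1 => NB h.
  have {}h := le_trans h (ler_wpM2r lam0 NB).
  have : t * w <= s%:R / q * lam * (y v `^ q * ((1 + t) `^ q - 1)).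
    rewrite NE in h.
    have rpE : r%:R / p = 1 - s%:R / q by apply: (canRL (addrK _)).
    rewrite rpE in h; lra.
  have := powR1Dx_sub1_le q0 t0 => /(ler_wpM2l (powR_ge0 (y v) q)).
  move=> /(ler_wpM2l (mulr_ge0 (ltW sq0) lam0)) h1 h2.
  rewrite -(ler_pM2l t0); apply: le_trans (le_trans h2 h1) _.
  by rewrite le_eqVlt; apply/orP; left; apply/eqP; field; rewrite gt_eqF.
set c := s%:R * lam * y v `^ q in step *.
have c0 : 0 <= c by rewrite !mulr_ge0 ?powR_ge0.
rewrite leNgt; apply/negP => cw.
have c1 : 0 < c.
  rewrite lt0r c0 andbT; apply/eqP => ce.
  have := step _ ltr01; rewrite ce mul0r; lra.
pose m := (c + w) / 2%:R.
have mc : 1 < m / c by rewrite ltr_pdivlMr// /m; lra.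
have Mgt : 1 < (m / c) `^ q^-1.
  have -> : 1 = 1 `^ q^-1 :> R by rewrite powR1.
  by apply: gt0_ltr_powR; rewrite ?nnegrE ?invr_gt0 ?ler01//; lra.
have := step ((m / c) `^ q^-1 - 1); rewrite subr_gt0 => /(_ Mgt).
rewrite addrC subrK -powRrM mulVf ?gt_eqF// powRr1; last by lra.
rewrite mulrC divfK ?gt_eqF// /m; lra.
Qed.

(* After taking logarithms, the estimate at an arc is [1 - p / q] times
   the sum of [arc_weight_le] over the head of the arc. *)
Lemma test_vector : p <= q -> 0 < lam ->
  exists (z : I -> R) (z' : J -> R), [/\ forall u, 0 <= z u,
    forall v, 0 <= z' v,
    \sum_u z u `^ (r + s)%:R + \sum_v z' v `^ (r + s)%:R = 1 &
    r%:R `^ (r%:R / p) * s%:R `^ (s%:R / q) * lam <=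
      ((r + s)%:R * biform z z') `^ ((r + s)%:R / p)].
Proof.
move=> pq lam0.
have [k kdef] : exists k : R, k = (r + s)%:R by exists (r + s)%:R.
have rR : 0 < r%:R :> R by rewrite ltr0n.
have sR : 0 < s%:R :> R by rewrite ltr0n.
have kE : k = r%:R + s%:R by rewrite kdef natrD.
have k0 : 0 < k by rewrite kE addr_gt0.
pose z u := (r%:R / k * x u `^ p) `^ k^-1.
pose z' v := (s%:R / k * y v `^ q) `^ k^-1.
have zk u : z u `^ k = r%:R / k * x u `^ p.
  rewrite /z -powRrM mulVf ?gt_eqF// powRr1// mulr_ge0 ?powR_ge0//.
  by rewrite ltW// divr_gt0.
have zk' v : z' v `^ k = s%:R / k * y v `^ q.
  rewrite /z' -powRrM mulVf ?gt_eqF// powRr1// mulr_ge0 ?powR_ge0//.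
  by rewrite ltW// divr_gt0.
rewrite -kdef; exists z, z'; split; try by move=> ?; exact: powR_ge0.
  under eq_bigr do rewrite zk; under [X in _ + X]eq_bigr do rewrite zk'.
  rewrite -!mulr_sumr ((pnorm_eq1_ge0 p0 x0).1 x1) ((pnorm_eq1_ge0 q0 y0).1 y1).
  by rewrite !mulr1 -mulrDl -kE mulfV ?gt_eqF.
set C := _ `^ _ * _ `^ _; set b := biform z z'.
have r_pow : 0 < r%:R `^ (r%:R / p) :> R by exact: powR_gt0.
have s_pow : 0 < s%:R `^ (s%:R / q) :> R by exact: powR_gt0.
have C0 : 0 < C by exact: mulr_gt0.
have CL0 : 0 < C * lam by exact: mulr_gt0.
suff H : (C * lam) `^ (p / k) <= k * b.
  have -> : C * lam = ((C * lam) `^ (p / k)) `^ (k / p).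
    by rewrite -powRrM mulrA divfK ?gt_eqF// mulfV ?gt_eqF// powRr1// ltW.
  apply: ge0_ler_powR => //; rewrite ?nnegrE ?powR_ge0//.
    by rewrite ltW// divr_gt0.
  exact: le_trans (powR_ge0 _ _) H.
(* Since the arc weights sum to [lam], the left side is distributed over the arcs in proportion to
   their weights; the inequality is then proved arc by arc. *)
have -> : (C * lam) `^ (p / k) =
    k * \sum_(e in D) (\prod_(u in A e) x u) * (\prod_(v in B e) y v) *
      ((C * lam) `^ (p / k) / (k * lam)).
  rewrite -mulr_suml -/(biform x y) lamE; field.
  by rewrite !gt_eqF.
rewrite ler_pM2l//; apply: ler_sum => e eD.
set X := \prod_(u in A e) x u; set Y := \prod_(v in B e) y v.
have X0 : 0 <= X by exact: prodr_ge0.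
have Y0 : 0 <= Y by exact: prodr_ge0.
(* Arcs of weight zero are set aside, so that all entries on the remaining arcs are positive and
   have logarithms. *)
have [w0|wN] := eqVneq (X * Y) 0.
  rewrite w0 mul0r; apply: mulr_ge0; apply: prodr_ge0 => *; exact: powR_ge0.
move: wN; rewrite mulf_eq0 negb_or => /andP[XN YN].
have {XN}X0 : 0 < X by rewrite lt0r XN.
have {YN}Y0 : 0 < Y by rewrite lt0r YN.
have xe u : u \in A e -> 0 < x u.
  move=> ue; rewrite lt0r x0 andbT; apply: contraTneq X0 => xu.
  by rewrite /X (bigD1 u)//= xu mul0r ltxx.
have ye v : v \in B e -> 0 < y v.
  move=> ve; rewrite lt0r y0 andbT; apply: contraTneq Y0 => yv.
  by rewrite /Y (bigD1 v)//= yv mul0r ltxx.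
have ze u : u \in A e -> 0 < z u.
  by move=> ue; rewrite /z powR_gt0// mulr_gt0 ?divr_gt0// powR_gt0// xe.
have ze' v : v \in B e -> 0 < z' v.
  by move=> ve; rewrite /z' powR_gt0// mulr_gt0 ?divr_gt0// powR_gt0// ye.
have lnz : ln (\prod_(u in A e) z u) =
    k^-1 * (r%:R * (ln r%:R - ln k) + p * ln X).
  have cardE : r%:R = \sum_(u in A e) 1 :> R.
    by rewrite -(card_A eD) -sum1_card natr_sum.
  rewrite !ln_prod// {1}cardE mulr_suml mulr_sumr -big_split mulr_sumr.
  apply: eq_bigr => u ue.
  rewrite /z ln_powR lnM ?posrE ?divr_gt0 ?powR_gt0 ?xe//.
  by rewrite ln_div ?posrE// ln_powR mul1r.
have lnz' : ln (\prod_(v in B e) z' v) =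
    k^-1 * (s%:R * (ln s%:R - ln k) + q * ln Y).
  have cardE : s%:R = \sum_(v in B e) 1 :> R.
    by rewrite -(card_B eD) -sum1_card natr_sum.
  rewrite !ln_prod// {1}cardE mulr_suml mulr_sumr -big_split mulr_sumr.
  apply: eq_bigr => v ve.
  rewrite /z' ln_powR lnM ?posrE ?divr_gt0 ?powR_gt0 ?ye//.
  by rewrite ln_div ?posrE// ln_powR mul1r.
have weight : s%:R * (ln X + ln Y) <= s%:R * (ln s%:R + ln lam) + q * ln Y.
  have -> : q * ln Y = \sum_(v in B e) q * ln (y v).
    by rewrite /Y ln_prod// mulr_sumr.
  have cardE : s%:R = \sum_(v in B e) 1 :> R.
    by rewrite -(card_B eD) -sum1_card natr_sum.
  rewrite {1 2}cardE !mulr_suml -big_split/=.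
  apply: ler_sum => v ve; rewrite !mul1r.
  have := arc_weight_le eD ve; rewrite -/X -/Y.
  rewrite -ler_ln ?posrE ?mulr_gt0 ?powR_gt0 ?ye//.
  rewrite lnM ?posrE// lnM ?posrE ?mulr_gt0 ?powR_gt0 ?ye//.
  by rewrite lnM ?posrE// ln_powR.
rewrite -ler_ln ?posrE; first last.
- by rewrite mulr_gt0 ?prodr_gt0.
- by rewrite !mulr_gt0 ?invr_gt0 ?powR_gt0 ?mulr_gt0.
rewrite [leRHS]lnM ?posrE ?prodr_gt0// lnz lnz'.
rewrite lnM ?posrE ?mulr_gt0 ?invr_gt0 ?powR_gt0 ?mulr_gt0//.
rewrite ln_div ?posrE ?powR_gt0 ?mulr_gt0// !ln_powR !lnM ?posrE// !ln_powR.
rewrite -(ler_pM2l k0) -subr_ge0.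
have pE : p = r%:R + p * s%:R / q.
  have : p * (r%:R / p + s%:R / q) = p by rewrite hpq mulr1.
  by rewrite mulrDr mulrCA mulfV ?gt_eqF// mulr1 mulrA.
have pq0 : 0 <= 1 - p / q by rewrite subr_ge0 ler_pdivrMr// mul1r.
move: weight; rewrite -subr_ge0 => /(mulr_ge0 pq0).
move/le_trans; apply; rewrite le_eqVlt; apply/orP; left; apply/eqP.
(* Eliminating [r] builds the relation [hpq] into the expressions; with the logarithms generalized,
   the remaining equality is an identity of rational functions. *)
have rE : r%:R = p - p * s%:R / q :> R by rewrite {1}pE addrK.
have kN := lt0r_neq0 k0; rewrite kE rE in kN.
move: (ln r%:R) (ln s%:R) (ln k) (ln lam) (ln X) (ln Y) => lr ls lk ll lX lY.
rewrite kE rE; field; rewrite (gt_eqF p0) (gt_eqF q0)/=.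
have := mulf_neq0 kN (lt0r_neq0 q0).
suff -> : (p - p * s%:R / q + s%:R) * q = p * q - p * s%:R + s%:R * q by [].
by field; rewrite gt_eqF.
Qed.

End Biform.

(** * The edges of the bipartite split and its polynomial form *)

Section Split.
Set Implicit Arguments.
Unset Strict Implicit.
Variables (R : realType) (V : finType) (r s : nat) (G : dihypergraph V r s).

Definition arc_tail (e : {set V} * {set V}) : {pred tailV G} :=
  fun u => val u \in e.1.
Definition arc_head (e : {set V} * {set V}) : {pred headV G} :=
  fun v => val v \in e.2.
Definition split_edge (e : {set V} * {set V}) : {set tailV G + headV G} :=
  split_tail G e.1 :|: split_head G e.2.

Lemma inl_split_edge e u : (inl u \in split_edge e) = (val u \in e.1).
Proof.
rewrite inE; apply/orP/idP => [[/imsetP[x + [->]]|/imsetP[x _ //]]|ue].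
  by rewrite inE.
by left; apply/imsetP; exists u; rewrite ?inE.
Qed.

Lemma inr_split_edge e v : (inr v \in split_edge e) = (val v \in e.2).
Proof.
rewrite inE; apply/orP/idP => [[/imsetP[x _ //]|/imsetP[x + [->]]]|ve].
  by rewrite inE.
by right; apply/imsetP; exists v; rewrite ?inE.
Qed.

Lemma mem_tails e u : e \in arcs G -> u \in e.1 -> u \in tails G.
Proof. by move=> eG ue; apply/bigcupP; exists e. Qed.

Lemma mem_heads e v : e \in arcs G -> v \in e.2 -> v \in heads G.
Proof. by move=> eG ve; apply/bigcupP; exists e. Qed.

(** Tail and head copies are kept apart by [inl] and [inr], so an edge determines its arc. Hence the
    sum over the set of edges in [hyper_poly] loses no arc. *)
Lemma split_edge_inj : {in arcs G &, injective split_edge}.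
Proof.
have sub1 a b : a \in arcs G -> split_edge a = split_edge b ->
    {subset a.1 <= b.1}.
  move=> aG ab u ua; have := inl_split_edge a (Sub u (mem_tails aG ua)).
  by rewrite ab inl_split_edge SubK ua.
have sub2 a b : a \in arcs G -> split_edge a = split_edge b ->
    {subset a.2 <= b.2}.
  move=> aG ab v va; have := inr_split_edge a (Sub v (mem_heads aG va)).
  by rewrite ab inr_split_edge SubK va.
move=> [a1 a2] [b1 b2] aG bG ab; congr (_, _); apply/setP => w; apply/idP/idP.
- exact: (sub1 _ _ aG ab).
- exact: (sub1 _ _ bG (esym ab)).
- exact: (sub2 _ _ aG ab).
- exact: (sub2 _ _ bG (esym ab)).
Qed.

Lemma split_hyperedges :
  hyperedges (underlying (bipartite_split G)) =
  [set split_edge e | e in arcs G].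
Proof. by rewrite /= /underlying_edges /= /split_arcs -imset_comp. Qed.

Lemma card_arc_tail e : e \in arcs G -> #|arc_tail e| = r.
Proof.
move=> eG; rewrite -[RHS](card_tail eG) -(card_split_tail eG) card_imset.
  by apply: eq_card => u; rewrite inE.
by move=> u v [].
Qed.

Lemma card_arc_head e : e \in arcs G -> #|arc_head e| = s.
Proof.
move=> eG; rewrite -[RHS](card_head eG) -(card_split_head eG) card_imset.
  by apply: eq_card => u; rewrite inE.
by move=> u v [].
Qed.

Lemma hyper_poly_split (z : tailV G + headV G -> R) :
  hyper_poly (underlying (bipartite_split G)) z =
  (r + s)%:R * biform (arcs G) arc_tail arc_head (z \o inl) (z \o inr).
Proof.
rewrite /hyper_poly split_hyperedges big_imset/=; last exact: split_edge_inj.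
congr (_ * _); apply: eq_bigr => e eG; rewrite big_sumType/=.
by congr (_ * _); apply: eq_bigl => w; rewrite ?inl_split_edge ?inr_split_edge.
Qed.

(** * The case without arcs: there is no vertex copy, hence no unit vector, and both suprema are
    [sup set0 = 0] *)

Section NoArc.
Hypothesis G0 : arcs G = finset.set0.

Lemma tailV_void : tailV G -> False.
Proof. by case=> u; rewrite /tails G0 big_set0 inE. Qed.

Lemma headV_void : headV G -> False.
Proof. by case=> u; rewrite /heads G0 big_set0 inE. Qed.

Lemma dihyper_lambda_void (p q : R) : 0 < p -> dihyper_lambda p q G = 0.
Proof.
move=> p0; rewrite /dihyper_lambda (_ : mkset _ = classical_sets.set0) ?sup0//.
apply/seteqP; split=> // t [x [y []]].
by rewrite (pnorm_void _ _ tailV_void)// => /esym/eqP; rewrite oner_eq0.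
Qed.

Lemma spectral_radius_void : (0 < r)%N ->
  spectral_radius R (underlying (bipartite_split G)) = 0.
Proof.
move=> r0; rewrite /spectral_radius (_ : mkset _ = classical_sets.set0) ?sup0//.
apply/seteqP; split=> // t [z []].
have k0 : 0 < (r + s)%:R :> R by rewrite ltr0n addn_gt0 r0.
rewrite pnorm_void//; first by move=> /esym/eqP; rewrite oner_eq0.
by case; [exact: tailV_void | exact: headV_void].
Qed.

End NoArc.

End Split.

(** * Comparison of the Lagrangian with the spectral radius *)

Theorem theorem5p10 (R : realType) (V : finType) (r s : nat)
    (G : dihypergraph V r s) (p q : R)
    (hr : (0 < r)%N) (hs : (0 < s)%N) (hp : 1 <= p) (hq : 1 <= q)
    (hpq : r%:R / p + s%:R / q = 1) :
  let rho : R := spectral_radius R (underlying (bipartite_split G)) in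
  [/\ (p <= q ->
        dihyper_lambda p q G <=
          1 / (r%:R `^ (r%:R / p) * s%:R `^ (s%:R / q)) *
            rho `^ ((r + s)%:R / p)),
      (q < p ->
        dihyper_lambda p q G <=
          1 / (r%:R `^ (r%:R / p) * s%:R `^ (s%:R / q)) *
            rho `^ ((r + s)%:R / q)) &
      (p = (r + s)%:R -> q = (r + s)%:R ->
        dihyper_lambda p q G =
          1 / ((r ^ r * s ^ s)%N%:R `^ (r + s)%:R^-1) * rho)].
Proof.
move=> rho.
have p0 : 0 < p by exact: lt_le_trans hp.
have q0 : 0 < q by exact: lt_le_trans hq.
have rpow : 0 < r%:R `^ (r%:R / p) :> R by rewrite powR_gt0 ?ltr0n.
have spow : 0 < s%:R `^ (s%:R / q) :> R by rewrite powR_gt0 ?ltr0n.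
have [G0|G0] := eqVneq (arcs G) finset.set0.
  rewrite /rho dihyper_lambda_void// spectral_radius_void//.
  by split=> *; rewrite ?mulr0// mulr_ge0 ?divr_ge0 ?mulr_ge0 ?powR_ge0.
set lam := dihyper_lambda p q G; set C := _ * _ `^ (s%:R / q).
have C0 : 0 < C by exact: mulr_gt0.
pose P := @biform R _ _ _ (arcs G) (@arc_tail V r s G) (@arc_head V r s G).
have [x1 [y1 [x1n y1n lamE lamM]]] := dihyper_lambda_max hr hs p0 q0 G0.
rewrite -/lam in lamE; rewrite -lamE in lamM.
have lamP x y : pnorm p x = 1 -> pnorm q y = 1 -> P x y <= lam := lamM x y.
pose x u := `|x1 u|; pose y v := `|y1 v|.
have x0 u : 0 <= x u by exact: normr_ge0.
have y0 v : 0 <= y v by exact: normr_ge0.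
have xn : pnorm p x = 1 by rewrite pnorm_norm.
have yn : pnorm q y = 1 by rewrite pnorm_norm.
(* Taking absolute values keeps the norms and cannot decrease the form, so it turns a maximizer into
   a nonnegative one. *)
have xyE : P x y = lam.
  by apply: le_anti; rewrite lamP//= lamE; exact: biform_le_norm.
have lam0 : 0 <= lam by rewrite -xyE biform_ge0.
have K0 : hyperedges (underlying (bipartite_split G)) != finset.set0.
  rewrite split_hyperedges; have /set0Pn[e eG] := G0.
  by apply/set0Pn; exists (split_edge G e); apply/imsetP; exists e.
have k0 : (0 < r + s)%N by rewrite addn_gt0 hr.
have kR : 0 < (r + s)%:R :> R by rewrite ltr0n.
have [t [tn rhoE rhoM]] := @spectral_radius_max R _ _ _ k0 K0.
rewrite -/rho in rhoE; rewrite -rhoE in rhoM.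
have rhoP z z' : (forall u, 0 <= z u) -> (forall v, 0 <= z' v) ->
    \sum_u z u `^ (r + s)%:R + \sum_v z' v `^ (r + s)%:R = 1 ->
    (r + s)%:R * P z z' <= rho.
  move=> z0 z'0 z1.
  pose zz w := match w with inl u => z u | inr v => z' v end.
  have := rhoM zz; rewrite hyper_poly_split; apply.
  apply/pnorm_eq1_ge0 => //; first by case.
  by rewrite big_sumType.
(* Common end of the first two cases, with [m] equal to [p] or [q]. A test vector is required only
   for [0 < lam], as the bound is trivial at 0. *)
have rho_bound m : 0 < m -> (0 < lam ->
    exists (z : tailV G -> R) (z' : headV G -> R), [/\ forall u, 0 <= z u,
      forall v, 0 <= z' v,
      \sum_u z u `^ (r + s)%:R + \sum_v z' v `^ (r + s)%:R = 1 &
      C * lam <= ((r + s)%:R * P z z') `^ ((r + s)%:R / m)]) ->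
    lam <= 1 / C * rho `^ ((r + s)%:R / m).
  move=> m0 test; have [<-|lamN] := eqVneq 0 lam.
    by rewrite mulr_ge0 ?powR_ge0 ?divr_ge0 ?ltW.
  have [|z [z' [z0 z'0 z1 h]]] := test; first by rewrite lt0r eq_sym lamN.
  rewrite mulrAC mul1r ler_pdivlMr// mulrC; apply: le_trans h _.
  have P0 : 0 <= (r + s)%:R * P z z'.
    by rewrite mulr_ge0 ?ler0n//; exact: biform_ge0.
  have le := rhoP z z' z0 z'0 z1.
  apply: ge0_ler_powR => //; first by rewrite divr_ge0 ?ltW.
  by rewrite nnegrE; exact: le_trans le.
have upper_p : p <= q -> lam <= 1 / C * rho `^ ((r + s)%:R / p).
  move=> pq; apply: rho_bound => // lam_gt0.
  exact: (test_vector hr hs (@card_arc_tail V r s G) (@card_arc_head V r s G)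
    hp hq lamP hpq x0 y0 xn yn xyE pq lam_gt0).
have upper_q : q < p -> lam <= 1 / C * rho `^ ((r + s)%:R / q).
  move=> /ltW qp; apply: rho_bound => // lam_gt0.
  (* The same form with heads as first argument, to which [test_vector] applies with [q <= p]. *)
  pose P' := @biform R _ _ _ (arcs G) (@arc_head V r s G) (@arc_tail V r s G).
  have swap a b : P' b a = P a b by apply: eq_bigr => e _; rewrite mulrC.
  have lamP' b a : pnorm q b = 1 -> pnorm p a = 1 -> P' b a <= lam.
    by move=> ? ?; rewrite swap lamP.
  have hqp : s%:R / q + r%:R / p = 1 by rewrite addrC.
  have [|z' [z [z'0 z0 z1 h]]] := test_vector hs hr (@card_arc_head V r s G)
    (@card_arc_tail V r s G) hq hp lamP' hqp y0 x0 yn xn _ qp lam_gt0.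
    by rewrite -/P' swap.
  rewrite -/P' swap addnC (mulrC (s%:R `^ _)) in h.
  by exists z, z'; rewrite addrC addnC in z1.
split=> // pk qk.
have pq : p = q by rewrite pk qk.
have -> : (r ^ r * s ^ s)%N%:R `^ (r + s)%:R^-1 = C :> R.
  rewrite natrM !natrX powRM ?exprn_ge0 ?ler0n// -!powR_mulrn ?ler0n//.
  by rewrite -!powRrM -{1}pk -qk.
(* The absolute values of a maximizer for [rho], cut into tail and head parts. *)
pose z u := `|t (inl u)|; pose z' v := `|t (inr v)|.
have z0 u : 0 <= z u by exact: normr_ge0.
have z'0 v : 0 <= z' v by exact: normr_ge0.
have z1 : \sum_u z u `^ (r + s)%:R + \sum_v z' v `^ (r + s)%:R = 1.
  by have := tn; rewrite Defs.pnorm_eq1// big_sumType.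
have rho0 : 0 <= rho.
  apply: le_trans (rhoP z z' z0 z'0 z1).
  by rewrite mulr_ge0 ?ler0n//; exact: biform_ge0.
(* One inequality is the first case, whose exponent [(r + s) / p] is now 1; the other is
   [degree_biform_le] at [z] and [z']. *)
apply: le_anti; apply/andP; split.
  have := upper_p; rewrite {1}pq lexx => /(_ isT).
  by rewrite -{1}pk mulfV ?gt_eqF// powRr1.
rewrite mulrAC mul1r ler_pdivrMr// mulrC rhoE hyper_poly_split.
have h := degree_biform_le hr hs (@card_arc_tail V r s G)
  (@card_arc_head V r s G) hp hq lamP pk qk lam0 z0 z'0 z1.
by apply: le_trans h; rewrite ler_wpM2l ?ler0n//; exact: biform_le_norm.
Qed.
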